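(* For all integers $k,n\ge 1$, we have $f(H(n,k))\le \lceil\sqrt{n}\,\rceil$. In fact, $H(n,k)$ has a bipartite induced subgraph with maximum degree at most $\lceil\sqrt{n}\,\rceil$ and more than $\alpha(H(n,k))$ vertices.
   Context: The Hamming graph $H(n,k)$ is the graph with vertex set $\Sigma^n$, where $\Sigma$ is an alphabet of size $k$, in which two vertices are adjacent if and only if they differ in precisely one coordinate. For a graph $G$, $\alpha(G)$ denotes the independence number of $G$ (the maximum size of an independent set), and $f(G)$ denotes the smallest maximum degree of induced subgraphs of $G$ with $\alpha(G)+1$ vertices.
   Formalization: The second sentence is stated for k ≥ 2 only, since H(n,1) has one vertex and α = 1, so no induced subgraph has more than α vertices; for k = 1 the undefined f(H(n,1)) is given the number of vertices, 1, by convention. *)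

(* Defs.v *)
From mathcomp Require Import all_boot.

Set Implicit Arguments.
Unset Strict Implicit.
Unset Printing Implicit Defensive.

Record sgraph := SGraph {
  vertex :> finType;
  adj : rel vertex;
  adj_sym : symmetric adj;
  adj_irrefl : irreflexive adj
}.
Arguments adj {s} : rename.

Section Graphs.
Variable G : sgraph.
Implicit Types (S A : {set G}) (x y : G).

Definition independent S := [forall x in S, forall y in S, ~~ adj x y].

Definition alpha : nat := \max_(S : {set G} | independent S) #|S|.

Definition degree x : nat := #|[set y | adj x y]|.

Definition max_degree : nat := \max_(x : G) degree x.

Definition bipartite := [exists A : {set G}, independent A && independent (~: A)].

Definition induced_adj S : rel {x : G | x \in S} :=
  fun u v => adj (val u) (val v).

Lemma induced_sym S : symmetric (@induced_adj S).
Proof. by move=> u v; apply: adj_sym. Qed.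

Lemma induced_irrefl S : irreflexive (@induced_adj S).
Proof. by move=> u; apply: adj_irrefl. Qed.

Definition induced S : sgraph := SGraph (@induced_sym S) (@induced_irrefl S).

End Graphs.

(* A degree in G is less than #|G|, so the default value #|G| of the minimum
   matters only when there is no set of alpha G + 1 vertices, that is, when G
   is edgeless (for example hamming n 1, whose single vertex gives alpha = 1). *)
Definition min_max_degree (G : sgraph) : nat :=
  \big[minn/#|G|]_(S : {set G} | #|S| == (alpha G).+1) max_degree (induced S).

Definition hamming_adj (n k : nat) : rel {ffun 'I_n -> 'I_k} :=
  fun x y => #|[set i | x i != y i]| == 1.

Lemma hamming_sym n k : symmetric (@hamming_adj n k).
Proof.
move=> x y; rewrite /hamming_adj; congr (#|pred_of_set _| == 1).
by apply/setP => i; rewrite !inE eq_sym.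
Qed.

Lemma hamming_irrefl n k : irreflexive (@hamming_adj n k).
Proof.
move=> x; rewrite /hamming_adj (_ : [set _ | _] = set0) ?cards0 //.
by apply/setP => i; rewrite !inE eqxx.
Qed.

Definition hamming (n k : nat) : sgraph :=
  SGraph (@hamming_sym n k) (@hamming_irrefl n k).

(* Main.v *)
(* Let m = ceil (sqrt n) and colour the coordinates by their residue mod m, which
   gives m nonempty blocks of at most m coordinates. Over the alphabet Z/k, each
   class {x | sum x = a} is independent and has at least alpha(H(n,k)) elements.
   Let S take from the class of a the words that vanish on some block, and from
   the class of b those that vanish on none. A word of the class of a has at most
   one neighbour in the class of b per coordinate; it loses all its zero blocks
   only if the changed coordinate lies in its unique zero block. A word of the
   class of b without zero block acquires one by a change in that block of its
   only nonzero coordinate. Hence all degrees in S are at most m. By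
   inclusion-exclusion the number of words without zero block is (-1)^m mod k,
   so these words are not equidistributed among the classes, and a and b can be
   chosen such that S is larger than the class of a. *)
Require Import Defs.
From mathcomp Require Import all_boot all_order all_algebra.
Import Order.TTheory GRing.Theory Num.Theory.
Local Open Scope ring_scope.

Set Implicit Arguments.
Unset Strict Implicit.
Unset Printing Implicit Defensive.

(** * Minima over families and maximum degrees of induced subgraphs *)

Lemma bigmin_leq_idx (I : Type) (r : seq I) (P : pred I) (F : I -> nat) d :
  (\big[minn/d]_(i <- r | P i) F i <= d)%N.
Proof.
by elim/big_rec: _ => // i x _ le_xd; rewrite (leq_trans (geq_minr _ _)).
Qed.

Lemma bigmin_leq (I : finType) (P : pred I) (F : I -> nat) d i0 :
  P i0 -> (\big[minn/d]_(i | P i) F i <= F i0)%N.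
Proof.
move=> Pi0; rewrite -big_filter.
have: i0 \in [seq i <- index_enum I | P i] by rewrite mem_filter Pi0 mem_index_enum.
elim: [seq _ <- _ | _] => // i r IHr; rewrite inE big_cons => /predU1P[<-|/IHr].
  exact: geq_minl.
exact/leq_trans/geq_minr.
Qed.

Section InducedSubgraphs.
Variable G : sgraph.
Implicit Types (S T : {set G}).

Lemma degree_induced S (u : induced S) :
  degree u = #|[set y in S | adj (val u) y]|.
Proof.
rewrite /degree -(card_imset _ val_inj); apply: eq_card => y.
apply/imsetP/idP => [[v uv ->]|]; first by rewrite inE in uv; rewrite inE (valP v).
by rewrite inE => /andP[yS uy]; exists (Sub y yS); rewrite // inE.
Qed.

Lemma max_degree_induced_leq S d :
  {in S, forall x, #|[set y in S | adj x y]| <= d}%N ->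
  (max_degree (induced S) <= d)%N.
Proof.
by move=> le_d; apply/bigmax_leqP => u _; rewrite degree_induced le_d // (valP u).
Qed.

Lemma max_degree_inducedS S T :
  S \subset T -> (max_degree (induced S) <= max_degree (induced T))%N.
Proof.
move=> /subsetP sST; apply: max_degree_induced_leq => x xS.
have xT := sST x xS; apply: leq_trans (leq_bigmax (Sub x xT : induced T)).
rewrite degree_induced; apply/subset_leq_card/subsetP => y.
by rewrite !inE => /andP[/sST-> ->].
Qed.

(** Deleting vertices never raises the maximum degree, so [S] may be cut down to exactly
    [(alpha G).+1] vertices. *)
Lemma min_max_degree_leq S :
  (alpha G < #|S|)%N -> (min_max_degree G <= max_degree (induced S))%N.
Proof.
case/card_geqP => s [s_uniq sz_s sub_s].
have sS : [set:: s] \subset S by apply/subsetP => x; rewrite inE; apply: sub_s.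
apply: leq_trans (max_degree_inducedS sS).
by apply: bigmin_leq; rewrite cardsE (card_uniqP s_uniq) sz_s.
Qed.

End InducedSubgraphs.

(** * Coordinate sums modulo the alphabet size and Hamming adjacency *)

Section HammingSums.
Variables n k : nat.
Notation V := (hamming n k.+2).
Implicit Types (x y : V) (i : 'I_n) (a b d : 'I_k.+2).

Definition coord_sum x : 'I_k.+2 := \sum_i x i.

Definition shift x d i : V := [ffun l => x l + d *+ (l == i)].

Lemma shift_eq x d i : shift x d i i = x i + d.
Proof. by rewrite ffunE eqxx mulr1n. Qed.

Lemma shift_neq x d i l : l != i -> shift x d i l = x l.
Proof. by move=> /negPf li; rewrite ffunE li addr0. Qed.

Lemma coord_sum_shift x d i : coord_sum (shift x d i) = coord_sum x + d.
Proof.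
rewrite /coord_sum; under eq_bigr do rewrite ffunE.
rewrite big_split /=; congr (_ + _).
by rewrite (bigD1 i) //= eqxx mulr1n big1 ?addr0 // => l /negPf->.
Qed.

Lemma shift0 x i : shift x 0 i = x.
Proof. by apply/ffunP => l; rewrite ffunE mul0rn addr0. Qed.

Lemma shift_shift x c d i : shift (shift x c i) d i = shift x (c + d) i.
Proof. by apply/ffunP => l; rewrite !ffunE mulrnDl addrA. Qed.

Lemma adj_shift x i d : d != 0 -> adj x (shift x d i).
Proof.
move=> d0; apply/cards1P; exists i; apply/setP => l; rewrite !inE ffunE.
rewrite -[X in X != _]addr0 (inj_eq (addrI _)) eq_sym.
by case: (l == i); [rewrite mulr1n d0 | rewrite eqxx].
Qed.

(** The sums differ by exactly the change in the one differing coordinate, so a neighbour is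
    determined by that coordinate and its own sum. *)
Lemma hamming_adjP x y : adj x y ->
  coord_sum y != coord_sum x /\
  exists i, y = shift x (coord_sum y - coord_sum x) i.
Proof.
move=> xy; have /cards1P[i Di] := xy.
have Dy : y = shift x (y i - x i) i.
  apply/ffunP => l; rewrite ffunE; have /setP/(_ l) := Di; rewrite !inE.
  case: (eqVneq l i) => [-> _|_ /negbFE/eqP->]; first by rewrite mulr1n addrC subrK.
  by rewrite addr0.
have Dd : coord_sum y - coord_sum x = y i - x i.
  by rewrite [in LHS]Dy coord_sum_shift addrAC subrr add0r.
split; last by exists i; rewrite Dd.
apply: contraTneq xy => /eqP; rewrite -subr_eq0 Dd => /eqP d0.
by rewrite Dy d0 shift0 adj_irrefl.
Qed.

Definition sum_class a : {set V} := [set x | coord_sum x == a].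

(** Correcting one fixed coordinate so that the sum becomes [a] is injective on an independent set:
    words with the same image agree off that coordinate, hence are equal or adjacent. *)
Lemma alpha_leq_sum_class a : (0 < n)%N -> (alpha V <= #|sum_class a|)%N.
Proof.
move=> n_gt0; pose o := Ordinal n_gt0; apply/bigmax_leqP => A /forall_inP indA.
pose g x := shift x (a - coord_sum x) o.
rewrite -(@card_in_imset _ _ g) => [|x y xA yA eq_g].
  apply/subset_leq_card/subsetP => _ /imsetP[x _ ->].
  by rewrite inE coord_sum_shift addrC subrK.
have Dy : y = shift x (coord_sum y - coord_sum x) o.
  transitivity (shift (g y) (- (a - coord_sum y)) o).
    by rewrite shift_shift subrr shift0.
  by rewrite -eq_g shift_shift addrC opprB addrA subrK.
apply/eqP; apply: contraT => neq_xy.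
have/forall_inP/(_ y yA) := indA x xA; rewrite Dy adj_shift // subr_eq0.
by apply: contraNneq neq_xy => eq_s; rewrite Dy eq_s subrr shift0.
Qed.

End HammingSums.

Arguments sum_class n {k} a.

(** * Words with and without zero blocks, and the switched set *)

Section Blocks.
Variables n k m : nat.
Variable blk : 'I_n -> 'I_m.
Hypothesis blk_surj : forall j, exists i, blk i = j.
Notation V := (hamming n k.+2).
Implicit Types (x y : V) (a b d : 'I_k.+2).

Definition vanishes x j := [forall i, (blk i == j) ==> (x i == 0)].
Definition has_zero_block x := [exists j, vanishes x j].

(** The count is a power of the alphabet size, with one factor for each coordinate outside the
    blocks of [J]; such a coordinate exists unless [J] is everything, as no block is empty. *)
Lemma card_vanishing (J : {set 'I_m}) :
  #|[set x : V | [forall j in J, vanishes x j]]|%:R = (J == setT)%:R :> 'I_k.+2.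
Proof.
pose F i := if blk i \in J then pred1 (0 : 'I_k.+2) else predT.
have ->: #|[set x : V | [forall j in J, vanishes x j]]| = #|family F|.
  apply: eq_card => x; rewrite inE; apply/forall_inP/familyP => [xJ i|xF j jJ].
    rewrite /F; case: ifP => // /xJ/forallP/(_ i); by rewrite eqxx inE.
  by apply/forallP => i; apply/implyP => /eqP Dj; have := xF i; rewrite /F Dj jJ.
rewrite card_family foldrE big_map big_enum /= natr_prod.
case: eqP => [DJ|/eqP].
  by rewrite big1 // => i _; rewrite /F DJ inE card1.
rewrite -subTset => /subsetPn[j _ jNJ]; have [i Di] := blk_surj j.
rewrite (bigD1 i) //= /F Di (negPf jNJ) card_ord.
by rewrite (@pchar_Zp k.+2) ?mul0r.
Qed.

(* Modulo the alphabet size, only the set of all blocks contributes to the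
   inclusion-exclusion sum. *)
Lemma card_no_zero_block :
  #|[set x : V | ~~ has_zero_block x]|%:R = (-1) ^+ m :> 'I_k.+2.
Proof.
transitivity (\sum_(x : V) \prod_j (- (vanishes x j)%:R + 1) : 'I_k.+2).
  rewrite -sum1_card natr_sum big_mkcond; apply: eq_bigr => x _; rewrite inE.
  case: (boolP (has_zero_block x)) => [/existsP[j xj]|xN] /=.
    by rewrite (bigD1 j) //= xj addNr mul0r.
  rewrite big1 // => j _; case: (boolP (vanishes x j)) => [xj|_];
    last by rewrite oppr0 add0r.
  by case/existsP: xN; exists j.
under eq_bigr do rewrite bigA_distr.
rewrite exchange_big /=.
transitivity (\sum_(J : {set 'I_m}) (-1) ^+ #|J| * (J == setT)%:R : 'I_k.+2).
  apply: eq_bigr => J _; rewrite -card_vanishing -[X in X%:R]sum1_card natr_sum mulr_sumr.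
  rewrite [RHS]big_mkcond; apply: eq_bigr => x _; rewrite inE -big_mkcond /=.
  case: forall_inP => [xJ|/forall_inP/forall_inPn[j jJ /negPf xj]].
    rewrite mulr1 -prodr_const; apply: eq_bigr => j /xJ-> //.
  by rewrite (bigD1 j) //= xj oppr0 mul0r.
rewrite (bigD1 setT) //= [X in _ + X]big1 ?addr0 => [|J /negPf->]; last exact: mulr0.
by rewrite eqxx mulr1 cardsT card_ord.
Qed.

Definition no_zero_class a : {set V} :=
  [set x in sum_class n a | ~~ has_zero_block x].

(** If all classes had equally many words without zero block, their total would be a multiple of
    [k.+2], whereas it is a sign modulo [k.+2]. *)
Lemma card_no_zero_class_neq :
  exists a b, (#|no_zero_class a| < #|no_zero_class b|)%N.
Proof.
suff /existsP[a /existsP[b lt_ab]] :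
    [exists a, exists b, #|no_zero_class a| < #|no_zero_class b|]%N by exists a, b.
apply: contraT => /existsPn all_geq.
have card_class a : #|no_zero_class a| = #|no_zero_class 0|.
  have geq b c : (#|no_zero_class c| <= #|no_zero_class b|)%N.
    by have /existsPn/(_ c) := all_geq b; rewrite -leqNgt.
  by apply/eqP; rewrite eqn_leq !geq.
suff: (-1) ^+ m = 0 :> 'I_k.+2.
  by move/eqP; rewrite signr_eq0.
rewrite -card_no_zero_block -sum1_card (partition_big (@coord_sum n k) predT) //=.
rewrite natr_sum (eq_bigr (fun=> #|no_zero_class 0|%:R)) => [|a _].
  by rewrite sumr_const card_ord -[LHS]mulr_natl (@pchar_Zp k.+2) ?mul0r.
rewrite sum1dep_card -(card_class a); congr _%:R.
by apply: eq_card => x; rewrite !inE andbC.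
Qed.

Definition zero_block_switch a b : {set V} :=
  [set x | coord_sum x == (if has_zero_block x then a else b)].

(** The switched set and the class of [a] contain the same words with a zero block and differ only
    in the others. *)
Lemma card_zero_block_switch a b :
  (#|no_zero_class a| + #|zero_block_switch a b|
   = #|no_zero_class b| + #|sum_class n a|)%N.
Proof.
pose Z := [set x : V | has_zero_block x].
rewrite -(cardsID Z (zero_block_switch a b)) -(cardsID Z (sum_class n a)).
have -> : sum_class n a :\: Z = no_zero_class a.
  by apply/setP => x; rewrite !inE andbC.
have -> : zero_block_switch a b :\: Z = no_zero_class b.
  by apply/setP => x; rewrite !inE; case: has_zero_block; rewrite ?andbF ?andbT.
have -> : zero_block_switch a b :&: Z = sum_class n a :&: Z.
  by apply/setP => x; rewrite !inE; case: has_zero_block; rewrite ?andbF ?andbT.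
by rewrite addnCA addnC -addnA addnC -!addnA; do 2?congr (_ + _)%N; rewrite addnC.
Qed.

Lemma bipartite_zero_block_switch a b : bipartite (induced (zero_block_switch a b)).
Proof.
apply/existsP; exists [set u | coord_sum (val u) == a].
apply/andP; split; apply/forall_inP => u uA; apply/forall_inP => v vA;
  apply/negP => /hamming_adjP[/eqP[]].
  by rewrite !inE in uA vA; rewrite (eqP uA) (eqP vA).
have b_sum (w : induced (zero_block_switch a b)) :
    w \in ~: [set u | coord_sum (val u) == a] -> coord_sum (val w) = b.
  rewrite !inE; have := valP w; rewrite inE.
  by case: ifP => _ /eqP-> //; rewrite eqxx.
by rewrite !b_sum.
Qed.

Variable c : nat.
Hypothesis card_block : forall j, (#|[set i | blk i == j]| <= c)%N.

Lemma max_degree_zero_block_switch a b :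
  (max_degree (induced (zero_block_switch a b)) <= maxn m c)%N.
Proof.
apply: max_degree_induced_leq => x; rewrite inE.
case: (boolP (has_zero_block x)) => xP /eqP sum_x.
  have /existsP[j /forallP xj] := xP; apply: leq_trans (leq_maxr _ _).
  apply: leq_trans (card_block j).
  (* A neighbour in the set has sum [b] and no zero block, so the changed coordinate lies in the
     zero block [j] of [x]. *)
  apply: leq_trans (leq_imset_card (shift x (b - a)) _).
  apply/subset_leq_card/subsetP => y; rewrite !inE => /andP[+ /hamming_adjP[]].
  rewrite sum_x; case: ifP => [_ /eqP->|yN /eqP sum_y _ [i Dy]]; first by rewrite eqxx.
  rewrite sum_y in Dy; rewrite Dy imset_f // inE; apply: contraFT yN => ij.
  apply/existsP; exists j; apply/forallP => l; apply/implyP => lj.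
  rewrite Dy shift_neq ?(implyP (xj l)) //.
  by apply: contraNneq ij => <-.
(* A neighbour with zero block [j] must annul the nonzero coordinate picked in [j]. The pick always
   succeeds, since [x] has no zero block. *)
pose w j := [pick i | (blk i == j) && (x i != 0)].
pose nb (j : 'I_m) := if w j is Some i then shift x (a - b) i else x.
apply: leq_trans (leq_maxl _ _); rewrite -[leqRHS]card_ord -cardsT.
apply: leq_trans (leq_imset_card nb _).
apply/subset_leq_card/subsetP => y; rewrite !inE => /andP[+ /hamming_adjP[]].
rewrite sum_x; case: ifP => [/existsP[j /forallP yj] /eqP sum_y _ [i Dy]|_ /eqP->];
  last by rewrite eqxx.
apply/imsetP; exists j; rewrite // /nb /w; case: pickP => [l /andP[lj xl]|xj].
  rewrite sum_y in Dy; case: (eqVneq l i) => [->//|li].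
  by case/negP: xl; have := implyP (yj l) lj; rewrite Dy shift_neq.
case/existsP: xP; exists j; apply/forallP => l; apply/implyP => lj.
by have := xj l; rewrite lj /= => /negbFE.
Qed.

End Blocks.

(** * Residue blocks and the ceiling of the square root *)

(** Within a residue class the quotient by [m] determines [i], and it is below [m]. *)
Lemma card_modn_class n m (j : 'I_m) :
  (n <= m * m)%N -> (#|[set i : 'I_n | i %% m == j :> nat]| <= m)%N.
Proof.
move=> le_n; have m_gt0 : (0 < m)%N := leq_ltn_trans (leq0n j) (ltn_ord j).
have lt_q (i : 'I_n) : (i %/ m < m)%N.
  by rewrite ltn_divLR // (leq_trans (ltn_ord i)).
pose q i := Ordinal (lt_q i).
rewrite -[leqRHS]card_ord -(@card_in_imset _ _ q) ?max_card // => i i'.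
rewrite !inE => /eqP ij /eqP i'j [eq_q]; apply: val_inj => /=.
by rewrite (divn_eq i m) (divn_eq i' m) ij i'j eq_q.
Qed.

Lemma hamming_switch n k m : (0 < m)%N -> (m <= n)%N -> (n <= m * m)%N ->
  exists S : {set hamming n k.+2},
    [/\ bipartite (induced S), (max_degree (induced S) <= m)%N &
        (alpha (hamming n k.+2) < #|S|)%N].
Proof.
move=> m_gt0 le_mn le_nmm.
pose blk (i : 'I_n) := Ordinal (ltn_pmod i m_gt0).
have blk_surj j : exists i, blk i = j.
  (* Coordinate [j] itself has residue [j]; it exists because [m <= n]. *)
  exists (widen_ord le_mn j); apply: val_inj; exact: modn_small (ltn_ord j).
have [a [b lt_ab]] := card_no_zero_class_neq k blk_surj.
exists (zero_block_switch blk a b); split.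
- exact: bipartite_zero_block_switch.
- rewrite -[leqRHS]maxnn; apply: max_degree_zero_block_switch => j.
  exact: card_modn_class.
- apply: leq_ltn_trans (alpha_leq_sum_class a (leq_trans m_gt0 le_mn)) _.
  by rewrite -(ltn_add2l #|no_zero_class blk a|) card_zero_block_switch ltn_add2r.
Qed.

Lemma ceil_sqrt_nat (R : archiRcfType) n : (0 < n)%N ->
  exists m, [/\ Num.ceil (Num.sqrt (n%:R : R)) = m%:Z,
                (0 < m)%N, (m <= n)%N & (n <= m * m)%N].
Proof.
move=> n_gt0; set s := Num.sqrt _.
have s_gt0 : 0 < s by rewrite sqrtr_gt0 ltr0n.
have: 0 < Num.ceil s by rewrite ceil_gt0.
case Dm: (Num.ceil s) => [m|//]; rewrite ltz_nat => m_gt0; exists m; split=> //.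
  (* The bound [m <= n] reduces to [s <= n], with [n] written as the root of its square. *)
  rewrite -lez_nat -Dm ceil_le_int -[leRHS]ger0_norm ?ler0n //.
  rewrite -sqrtr_sqr ler_sqrt ?exprn_ge0 ?ler0n // -natrX ler_nat.
  by rewrite leq_pmulr.
have := ceil_ge s; rewrite Dm => le_sm.
rewrite -(ler_nat R) -[leLHS]sqr_sqrtr ?ler0n // natrM -expr2.
by rewrite ler_pXn2r ?nnegrE ?ler0n // ltW.
Qed.

Theorem theorem1p2 (R : archiRcfType) (k n : nat) (hk : (1 <= k)%N) (hn : (1 <= n)%N) :
  (min_max_degree (hamming n k))%:Z <= Num.ceil (Num.sqrt (n%:R : R)) /\
  ((2 <= k)%N ->
   exists S : {set hamming n k},
     [/\ bipartite (induced S),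
         (max_degree (induced S))%:Z <= Num.ceil (Num.sqrt (n%:R : R)) &
         (alpha (hamming n k) < #|S|)%N]).
Proof.
have [m [-> m_gt0 le_mn le_nmm]] := ceil_sqrt_nat R hn.
case: k hk => [//|[_|k' _]].
  (* Over a one-letter alphabet there is a single word, so the default value of the minimum is 1,
     which is at most [m]. *)
  split=> //; rewrite lez_nat (leq_trans (bigmin_leq_idx _ _ _ _)) //.
  by rewrite card_ffun !card_ord exp1n.
have [S [bipS degS cardS]] := hamming_switch k' m_gt0 le_mn le_nmm.
split=> [|_]; last by exists S.
by rewrite lez_nat (leq_trans (min_max_degree_leq cardS)).
Qed.
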